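(* Let $T$ be a tree. Then $T$ has a unique minimum edge-vertex dominating set if and only if $T$ has a unique minimum paired-dominating set. (That is, the class of trees having unique minimum edge-vertex dominating sets coincides with the class of trees having unique minimum paired-dominating sets.)
   Context: All graphs are finite and simple. For a graph $G=(V_G,E_G)$, a set $D\subseteq V_G$ is dominating if every vertex of $V_G\setminus D$ has a neighbour in $D$. A set $D\subseteq V_G$ is a paired-dominating set if it is dominating and the induced subgraph $G[D]$ has a perfect matching; a minimum paired-dominating set is one of minimum cardinality. An edge $e$ ev-dominates a vertex $v$ if $e$ is incident to $v$ or $e$ is incident to a vertex adjacent to $v$. A set $M\subseteq E_G$ is an edge-vertex dominating set if every vertex of $G$ is ev-dominated by some edge of $M$; a minimum edge-vertex dominating set is one of minimum cardinality. *)

(* Defs.v *)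
From mathcomp Require Import all_boot.

Set Implicit Arguments.
Unset Strict Implicit.
Unset Printing Implicit Defensive.

(* A finite simple graph is a symmetric irreflexive adjacency
   relation on a finType; symmetry and irreflexivity are hypotheses of the
   results rather than parts of the definitions below. *)

Section Graphs.
Variable V : finType.
Implicit Types (adj : rel V) (D : {set V}) (E : {set V}) (M : {set {set V}}).

(* Excludes the graph without vertices. *)
Definition connected_graph adj : Prop :=
  0 < #|V| /\ forall x y : V, connect adj x y.

(* The bound 3 <= size c is needed because [cycle adj [:: x; y]] holds for
   every edge xy. *)
Definition acyclic_graph adj : Prop :=
  forall c : seq V, 3 <= size c -> uniq c -> ~~ cycle adj c.

Definition is_tree adj : Prop := connected_graph adj /\ acyclic_graph adj.

(* An edge is the unordered pair of its ends. *)
Definition edges adj : {set {set V}} :=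
  [set E | [exists x, exists y, adj x y && (E == [set x; y])]].

(* G[D], kept on the vertex type V; it has no edge meeting the complement
   of D. *)
Definition induced adj D : rel V :=
  [rel x y | [&& x \in D, y \in D & adj x y]].

Definition perfect_matching adj D M : bool :=
  [&& M \subset edges (induced adj D), trivIset M & cover M == D].

Definition dominating adj D : bool :=
  [forall v in ~: D, exists u in D, adj v u].

Definition paired_dominating adj D : bool :=
  dominating adj D && [exists M, perfect_matching adj D M].

Definition ev_dominates adj E (v : V) : bool :=
  (v \in E) || [exists u in E, adj u v].

Definition ev_dominating adj M : bool :=
  (M \subset edges adj) && [forall v, exists E in M, ev_dominates adj E v].

End Graphs.

(* Minimum cardinality, as opposed to [minset], which is minimality for
   inclusion. *)
Definition minimum_set (T : finType) (P : pred {set T}) (A : {set T}) : Prop :=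
  P A /\ forall B : {set T}, P B -> #|A| <= #|B|.

(* Main.v *)
Require Import Defs.
From mathcomp Require Import all_boot.

(** If two edges [u w] and [u v] of a minimum ev-dominating set [M] meet, then
    [u w] is the only edge of [M] that ev-dominates some vertex [w'], which lies
    outside [cover M] and is adjacent to [w]; exchanging [u w] for [w w'] gives
    another minimum ev-dominating set, which covers [w'] in addition to
    [cover M].  Iterating, some minimum ev-dominating set is a matching, so the
    minimum paired-dominating sets are exactly the covers of the minimum
    ev-dominating matchings.  Left to right, the exchange forces a unique [M] to
    be a matching.  Right to left, take a non-matching [M] with the largest cover:
    exchanging [u w], respectively [u v], yields matchings with distinct covers
    [w' |: cover M] and [v' |: cover M], so a unique paired-dominating set
    excludes non-matchings; finally a forest has at most one perfect matching. *)

Set Implicit Arguments.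
Unset Strict Implicit.
Unset Printing Implicit Defensive.

Section Domination.
Variables (V : finType) (adj : rel V).
Hypotheses (adj_sym : symmetric adj) (adj_irr : irreflexive adj).
Implicit Types (D : {set V}) (E F : {set V}) (M N : {set {set V}}).

Let ev := ev_dominating adj.
Let pd := paired_dominating adj.

(** * Domination by edges in terms of covers *)

Lemma edges_set2 x y : adj x y -> [set x; y] \in edges adj.
Proof.
move=> xy; rewrite inE; apply/existsP; exists x; apply/existsP; exists y.
by rewrite xy eqxx.
Qed.

Lemma edge_other_end E x :
  E \in edges adj -> x \in E -> exists2 y, adj x y & E = [set x; y].
Proof.
rewrite inE => /existsP[a /existsP[b /andP[ab /eqP->]]].
rewrite !inE => /orP[]/eqP->; first by exists b.
by exists a; rewrite 1?adj_sym // setUC.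
Qed.

Lemma card_edge E : E \in edges adj -> #|E| = 2.
Proof.
rewrite inE => /existsP[a /existsP[b /andP[ab /eqP->]]]; rewrite cards2.
by case: eqP ab => // ->; rewrite adj_irr.
Qed.

Lemma ev_dominates_set2 x y v :
  adj x y -> ev_dominates adj [set x; y] v = adj x v || adj y v.
Proof.
move=> xy; apply/idP/idP.
  case/orP; first by rewrite !inE => /orP[]/eqP->; rewrite 1?[adj y x]adj_sym xy ?orbT.
  by case/exists_inP=> u; rewrite !inE => /orP[]/eqP-> ->; rewrite ?orbT.
move=> H; apply/orP; right; apply/exists_inP.
by case/orP: H => H; [exists x | exists y]; rewrite // !inE eqxx ?orbT.
Qed.

Lemma dominatingS D D' : D \subset D' -> dominating adj D -> dominating adj D'.
Proof.
move=> sDD' /forall_inP domD; apply/forall_inP=> v; rewrite inE => vD'.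
have /domD/exists_inP[u uD vu] : v \in ~: D.
  by rewrite inE; apply: contra vD'; apply: subsetP.
by apply/exists_inP; exists u; rewrite // (subsetP sDD').
Qed.

(** An edge ev-dominates exactly its ends and their neighbours, so a set of edges matters only
    through the union of its edges. *)
Lemma ev_dominating_cover M :
  ev_dominating adj M = (M \subset edges adj) && dominating adj (cover M).
Proof.
rewrite /ev_dominating; congr (_ && _); apply/idP/idP.
  move/forallP=> dom; apply/forall_inP=> v; rewrite inE => vM.
  have /exists_inP[E EM /orP[vE|/exists_inP[u uE uv]]] := dom v.
    by case/negP: vM; apply/bigcupP; exists E.
  by apply/exists_inP; exists u; rewrite 1?adj_sym //; apply/bigcupP; exists E.
move/forall_inP=> dom; apply/forallP=> v; apply/exists_inP.
case: (boolP (v \in cover M)) => [/bigcupP[E EM vE]|vM].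
  by exists E; rewrite // /ev_dominates vE.
have /dom/exists_inP[u /bigcupP[E EM uE] vu] : v \in ~: cover M by rewrite inE.
exists E; rewrite // /ev_dominates; apply/orP; right; apply/exists_inP.
by exists u; rewrite // adj_sym.
Qed.

Lemma card_cover_matching M :
  M \subset edges adj -> trivIset M -> #|cover M| = #|M| * 2.
Proof.
move=> sM /eqP <-; rewrite -sum_nat_const; apply: eq_bigr => E EM.
by rewrite card_edge // (subsetP sM).
Qed.

(** Once [cover M] is [D], every edge of [M] has both ends in [D] and so lies in the induced
    graph. *)
Lemma perfect_matchingE D M :
  perfect_matching adj D M = [&& M \subset edges adj, trivIset M & cover M == D].
Proof.
rewrite /perfect_matching; case: eqP => [<-|]; last by rewrite !andbF.
congr (_ && _); apply/subsetP/subsetP=> sM E EM; have := sM _ EM.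
  rewrite inE => /existsP[x /existsP[y /andP[/and3P[_ _ xy] /eqP->]]].
  exact: edges_set2.
rewrite !inE => /existsP[x /existsP[y /andP[xy /eqP eE]]].
apply/existsP; exists x; apply/existsP; exists y.
rewrite eE eqxx andbT /induced /= xy andbT.
by apply/andP; split; apply/bigcupP; exists E; rewrite // eE !inE eqxx ?orbT.
Qed.

Lemma paired_dominatingP D :
  reflect (exists M, [/\ ev_dominating adj M, trivIset M & cover M = D])
          (paired_dominating adj D).
Proof.
apply: (iffP andP) => [[domD /existsP[M]]|[M []]].
  rewrite perfect_matchingE => /and3P[sM tM /eqP cM].
  by exists M; rewrite ev_dominating_cover sM cM.
rewrite ev_dominating_cover => /andP[sM domM] tM <-; split=> //.
by apply/existsP; exists M; rewrite perfect_matchingE sM tM eqxx.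
Qed.

(** * Exchanging one of two meeting edges *)

Lemma minimum_ev_exchange M E F :
    minimum_set ev M -> E \in M -> F \in M -> E != F -> ~~ [disjoint E & F] ->
  exists w M', [/\ w \notin cover M, {in M, forall X, ev_dominates adj X w -> X = E},
                   minimum_set ev M' & cover M' = w |: cover M].
Proof.
case=> evM minM EM FM neEF /pred0Pn[u /andP[/= uE uF]].
have [sM domM] : M \subset edges adj /\ dominating adj (cover M).
  by apply/andP; rewrite -ev_dominating_cover.
have [w uw eE] := edge_other_end (subsetP sM _ EM) uE.
have [v uv eF] := edge_other_end (subsetP sM _ FM) uF.
have sME : M :\ E \subset edges adj by apply: subset_trans sM; apply: subD1set.
(* By minimality [M :\ E] is not ev-dominating; a vertex [w'] that it misses is private to [E]. *)
have /forallPn[w' /exists_inPn w'P] :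
    ~~ [forall v, exists X in M :\ E, ev_dominates adj X v].
  apply/negP=> H; have : ev (M :\ E) by rewrite /ev /ev_dominating sME.
  by move/minM; rewrite (cardsD1 E M) EM ltnn.
have w'only : {in M, forall X, ev_dominates adj X w' -> X = E}.
  move=> X XM Xw'; apply/eqP; apply: contraLR Xw' => nXE; apply: w'P.
  by rewrite !inE nXE.
(* [F] also contains [u], so it would ev-dominate any neighbour of [u]. *)
have uw' : adj u w' = false.
  apply: contraNF neEF => uw'; apply/eqP/esym/w'only => //.
  by rewrite eF ev_dominates_set2 ?uw'.
have ww' : adj w w'.
  have /exists_inP[X XM Xw'] := forallP (andP evM).2 w'.
  by move: (Xw'); rewrite (w'only X) // eE ev_dominates_set2 // uw'.
have w'M : w' \notin cover M.
  apply/negP=> /bigcupP[X XM w'X].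
  have XE : X = E by apply: w'only; rewrite // /ev_dominates w'X.
  move: w'X; rewrite XE eE !inE => /orP[]/eqP ew'.
    by case/eqP: neEF; apply/esym/w'only; rewrite // /ev_dominates ew' uF.
  by rewrite ew' uw in uw'.
(* Dropping [E] uncovers nothing: [u] stays on [F], and [w] is on the new edge. *)
pose M' := [set w; w'] |: M :\ E.
have cM' : cover M' = w' |: cover M.
  apply/setP=> x; rewrite in_setU1; apply/bigcupP/idP => [[X]|].
    rewrite !inE => /orP[/eqP->|/andP[_ XM] xX]; last first.
      by apply/orP; right; apply/bigcupP; exists X.
    rewrite !inE => /orP[]/eqP->; last by rewrite eqxx.
    by apply/orP; right; apply/bigcupP; exists E; rewrite // eE !inE eqxx orbT.
  have ww'M' : [set w; w'] \in M' by rewrite !inE eqxx.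
  case/orP=> [/eqP->|/bigcupP[X XM xX]].
    by exists [set w; w']; rewrite // !inE eqxx orbT.
  have [XE|nXE] := eqVneq X E; last by exists X; rewrite // !inE nXE XM orbT.
  move: xX; rewrite XE eE !inE => /orP[]/eqP->.
    by exists F; rewrite // !inE [F == E]eq_sym neEF FM orbT.
  by exists [set w; w']; rewrite // !inE eqxx.
exists w', M'; split=> //; split.
  rewrite /ev ev_dominating_cover subUset sub1set edges_set2 // sME /=.
  by apply: dominatingS domM; rewrite cM' subsetUr.
move=> B /minM; apply: leq_trans.
by rewrite (cardsD1 E M) EM /M' cardsU1 leq_add2r leq_b1.
Qed.

Lemma nontrivIset M :
  ~~ trivIset M ->
  exists E F, [/\ E \in M, F \in M, E != F & ~~ [disjoint E & F]].
Proof.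
move=> ntM.
case: (boolP [exists E in M, exists F in M, (E != F) && ~~ [disjoint E & F]]).
  by case/exists_inP=> E EM /exists_inP[F FM /andP[? ?]]; exists E, F.
move=> /exists_inPn H; case/negP: ntM; apply/trivIsetP=> E F EM FM nEF.
have /exists_inPn/(_ F FM) := H E EM.
by rewrite nEF negbK.
Qed.

(** A minimum set with the largest cover is a matching, since an exchange would enlarge the cover.
    [M] only witnesses that ev-dominating sets exist. *)
Lemma minimum_ev_matching M :
  ev M -> exists2 N, minimum_set ev N & trivIset N.
Proof.
move=> evM; pose K := [arg min_(K < M | ev K) #|K|].
have [evK minK] : minimum_set ev K by rewrite /K; case: arg_minnP.
case: (@arg_maxnP _ K (fun N => ev N && (#|N| == #|K|)) (fun N => #|cover N|)).
  by rewrite evK eqxx.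
move=> N /andP[evN /eqP cardN] maxN.
have minN : minimum_set ev N by split=> // B; rewrite cardN; apply: minK.
exists N => //; apply: contraT => /nontrivIset[E [F [EN FN nEF dEF]]].
have [w [M' [wN _ [evM' minM'] cM']]] := minimum_ev_exchange minN EN FN nEF dEF.
have := maxN M'; rewrite evM' cM' cardsU1 wN /= ltnn => H.
by apply: H; rewrite -cardN eqn_leq minM' // cardN minK.
Qed.

(** A matching covers twice as many vertices as it has edges. From right to left the competitor [B]
    may fail to be a matching, so it is compared through a minimum matching [N]. *)
Lemma minimum_paired_cover M :
  ev M -> trivIset M -> minimum_set ev M <-> minimum_set pd (cover M).
Proof.
have card N : ev N -> trivIset N -> #|cover N| = #|N| * 2.
  by rewrite /ev => /andP[sN _]; apply: card_cover_matching.
move=> evM tM; split=> [[_ minM]|[_ minM]]; split=> //.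
- by apply/paired_dominatingP; exists M.
- move=> _ /paired_dominatingP[N [evN tN <-]].
  by rewrite !card // leq_mul2r /=; apply: minM.
move=> B evB; have [N [evN minN] tN] := minimum_ev_matching evB.
have /minM : pd (cover N) by apply/paired_dominatingP; exists N.
by rewrite !card // leq_mul2r /= => /leq_trans -> //; apply: minN.
Qed.

Lemma unique_paired_minimum_ev_matching D M :
  (forall D', minimum_set pd D' -> D' = D) -> minimum_set ev M -> trivIset M.
Proof.
move=> uniqD [evM minM]; apply: contraT => ntM.
(* The largest cover is taken among the non-matchings of minimum size, so every exchange leaves this
   class and yields a matching. *)
pose P N := [&& ev N, #|N| == #|M| & ~~ trivIset N].
have PM : P M by rewrite /P evM eqxx.
case: (@arg_maxnP _ M P (fun N => #|cover N|) PM) => N /and3P[evN /eqP cardN ntN] maxN.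
have minN : minimum_set ev N by split=> // B; rewrite cardN; apply: minM.
have exchange E F : E \in N -> F \in N -> E != F -> ~~ [disjoint E & F] ->
    exists w, [/\ w \notin cover N, {in N, forall X, ev_dominates adj X w -> X = E}
                & w |: cover N = D].
  move=> EN FN nEF dEF.
  have [w [N' [wN wE minN' cN']]] := minimum_ev_exchange minN EN FN nEF dEF.
  exists w; split=> //; rewrite -cN'; case: (minN') => evN' leN'.
  apply: uniqD; apply/minimum_paired_cover => //; apply: contraT => ntN'.
  have := maxN N'; rewrite cN' cardsU1 wN /= ltnn => H.
  by apply: H; rewrite /P evN' ntN' andbT -cardN eqn_leq leN' // (minN.2 _ evN').
have [E [F [EN FN nEF dEF]]] := nontrivIset ntN.
have [w [wN wE wD]] := exchange E F EN FN nEF dEF.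
have [||v [vN vF vD]] := exchange F E FN EN; rewrite 1?eq_sym 1?disjoint_sym //.
(* Both new covers equal [D], so [w = v]; an edge of [N] ev-dominating this vertex would be both [E]
   and [F]. *)
have : w \in v |: cover N by rewrite vD -wD setU11.
rewrite in_setU1 (negPf wN) orbF => /eqP ewv.
have /exists_inP[X XN Xw] := forallP (andP evN).2 w.
by rewrite -(wE X XN Xw) -(vF X XN) ?eqxx // -ewv in nEF.
Qed.

(** * Perfect matchings of forests *)

(* Otherwise paths in [S] could be extended indefinitely without repetition. *)
Lemma acyclic_leaf (S : {set V}) :
    acyclic_graph adj -> S != set0 ->
  exists2 x, x \in S & {in S &, forall y z, adj x y -> adj x z -> y = z}.
Proof.
move=> acyc /set0Pn[x0 x0S].
case: (boolP [exists x in S, [forall y in S, forall z in S,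
                 adj x y ==> adj x z ==> (y == z)]]) => [|/exists_inPn branch].
  case/exists_inP=> x xS /forall_inP H; exists x => // y z yS zS xy xz.
  by move/forall_inP/(_ z zS): (H y yS); rewrite xy xz => /eqP.
have other x y : x \in S -> exists z, [/\ z \in S, adj x z & z != y].
  move=> xS; have /forall_inPn[a aS /forall_inPn[b bS]] := branch x xS.
  rewrite !negb_imply => /and3P[xa xb nab].
  have [eay|] := eqVneq a y; last by exists a.
  by exists b; rewrite bS xb -eay eq_sym.
have long n : exists x p, [/\ size p = n, path adj x p, uniq (x :: p)
                             & {subset x :: p <= S}].
  elim: n => [|n [x [p [sz pth un sub]]]].
    by exists x0, [::]; split=> // z; rewrite inE => /eqP->.
  have xS : x \in S by apply: sub; rewrite mem_head.
  (* The path grows at its front [x], without turning back to the next vertex. For empty [p] the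
     default only asks for [z != x], which adjacency gives anyway. *)
  have [z [zS xz nz]] := other x (head x p) xS.
  have zx : adj z x by rewrite adj_sym.
  case: (boolP (z \in x :: p)) => [|zp]; last first.
    exists z, (x :: p); split; rewrite /= ?sz ?zx //; first by rewrite zp.
    by move=> t; rewrite inE => /predU1P[->//|]; apply: sub.
  rewrite inE => /predU1P[ezx|zp]; first by rewrite ezx adj_irr in xz.
  case/splitPr: zp pth un nz => p1 p2 pth un nz.
  (* As [z] is not the head of [p], the segment [p1] is nonempty, and the closed walk is a genuine
     cycle. *)
  have sz3 : 3 <= size (x :: rcons p1 z).
    by case: p1 nz {pth un} => [|a p1] /=; rewrite ?eqxx // size_rcons.
  have un1 : uniq (x :: rcons p1 z).
    by move: un; rewrite -cat_rcons -cat_cons cat_uniq => /andP[].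
  case/negP: (acyc _ sz3 un1).
  move: pth; rewrite -cat_rcons cat_path => /andP[pth _].
  by rewrite /cycle rcons_path pth last_rcons.
have [x [p [sz _ un _]]] := long #|V|.
by have := max_card [in x :: p]; rewrite (card_uniqP un) /= sz ltnn.
Qed.

Lemma pblock_matching M x :
    M \subset edges adj -> trivIset M -> x \in cover M ->
  exists y, [/\ adj x y, pblock M x = [set x; y], pblock M y = [set x; y]
              & y \in cover M].
Proof.
move=> sM tM xM; have BM := pblock_mem xM.
have xB : x \in pblock M x by rewrite mem_pblock.
have [y xy eB] := edge_other_end (subsetP sM _ BM) xB.
have yB : y \in pblock M x by rewrite eB set22.
exists y; split=> //; first by rewrite -eB (def_pblock tM BM yB).
by apply/bigcupP; exists (pblock M x).
Qed.

Lemma acyclic_matching_inj M N :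
    acyclic_graph adj -> M \subset edges adj -> N \subset edges adj ->
  trivIset M -> trivIset N -> cover M = cover N -> M = N.
Proof.
move=> acyc sM sN tM tN cMN.
(* On [S] the matchings differ. The two partners of a vertex of [S] are distinct and again in [S],
   so [S] has no leaf and must be empty. *)
pose S := [set x in cover M | pblock M x != pblock N x].
have S0 : S = set0.
  apply/eqP; apply: contraT => /(acyclic_leaf acyc)[x].
  rewrite inE => /andP[xM neq] leaf; have xN : x \in cover N by rewrite -cMN.
  have [y [xy Mx My yM]] := pblock_matching sM tM xM.
  have [z [xz Nx Nz zN]] := pblock_matching sN tN xN.
  suff eyz : y = z by rewrite Mx Nx eyz eqxx in neq.
  (* If the matchings shared the edge at a partner of [x], that edge would contain [x], and they
     would agree at [x]. *)
  apply: leaf => //; rewrite inE ?yM ?cMN ?zN /=.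
    rewrite My -Mx; apply: contra neq => /eqP eB; rewrite eB.
    by apply/eqP/esym/same_pblock; rewrite // -eB Mx set21.
  rewrite Nz -Nx; apply: contra neq => /eqP eB; rewrite -eB.
  by apply/eqP/same_pblock; rewrite // eB Nx set21.
suff sub (A B : {set {set V}}) : A \subset edges adj -> trivIset A ->
    {in cover A, pblock A =1 pblock B} -> cover A = cover B -> A \subset B.
  have eqMN : {in cover M, pblock M =1 pblock N}.
    move=> x xM; apply/eqP; apply: contraT => neq.
    by have := in_set0 x; rewrite -S0 inE xM neq.
  apply/eqP; rewrite eqEsubset; apply/andP; split; apply: sub => // x.
  by rewrite -cMN => xM; rewrite eqMN.
move=> sA tA eqAB cAB; apply/subsetP=> E EA.
have /card_gt0P[x xE] : 0 < #|E| by rewrite card_edge // (subsetP sA).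
have xA : x \in cover A by apply/bigcupP; exists E.
by rewrite -(def_pblock tA EA xE) eqAB // pblock_mem // -cAB.
Qed.

End Domination.

Theorem theorem2 (V : finType) (adj : rel V)
    (adj_sym : symmetric adj) (adj_irr : irreflexive adj)
    (adj_tree : is_tree adj) :
  (exists! M : {set {set V}}, minimum_set (ev_dominating adj) M) <->
  (exists! D : {set V}, minimum_set (paired_dominating adj) D).
Proof.
have pairedP := paired_dominatingP adj_sym.
have min_cover := minimum_paired_cover adj_sym adj_irr.
split=> [[M [minM uniqM]]|[D [minD uniqD]]].
  have tM : trivIset M.
    apply: contraT => /nontrivIset[E [F [EM FM nEF dEF]]].
    have [w [M' [wM _ minM' cM']]] := minimum_ev_exchange adj_sym minM EM FM nEF dEF.
    by rewrite (uniqM _ minM') cM' setU11 in wM.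
  exists (cover M); split=> [|D minD]; first by apply/min_cover => //; case: minM.
  have /pairedP[N [evN tN cN]] := minD.1.
  by rewrite (uniqM N) //; apply/min_cover; rewrite ?cN.
have /pairedP[M [evM tM cM]] := minD.1.
exists M; split=> [|N minN]; first by apply/min_cover; rewrite ?cM.
have tN : trivIset N.
  apply: (unique_paired_minimum_ev_matching adj_sym adj_irr (D := D)) minN.
  by move=> D' /uniqD.
case: adj_tree => _ acyc; case: (minN) => evN _.
(* [cover N] is a minimum paired-dominating set, hence equals [D], so [M] and [N] match the same
   vertices. *)
apply: (acyclic_matching_inj adj_sym adj_irr acyc) => //.
- by case/andP: evM.
- by case/andP: evN.
by rewrite cM; apply: uniqD; apply/min_cover.
Qed.
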